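(* For each integer $n\ge 3$ let $\alpha'_{c,n}$ be the critical loading rate and $m_{c,n}\in(0,1)$ the critical overlap of the fixed-point equation $$m=\operatorname{erf}\!\left(\frac{m^{n-1}}{\sqrt{2\alpha'}}\right),\qquad m\in[0,1],\ \alpha'>0,$$ as defined in the context. Then, as $n\to\infty$, $$\alpha'_{c,n}=\frac{1}{2\ln n}\left[1+O\!\left(\frac{\ln\ln n}{\ln n}\right)\right]$$ and $$m_{c,n}=1-\frac{1}{2n\ln n}\left[1+O\!\left(\frac{\ln\ln n}{\ln n}\right)\right].$$
   Context: Here $\operatorname{erf}(z)=\frac{2}{\sqrt{\pi}}\int_0^z e^{-s^2}\,ds$ and $\ln$ is the natural logarithm. For an integer $n\ge 3$ and $\alpha'>0$ put $F_{n,\alpha'}(m)=\operatorname{erf}\!\big(m^{n-1}/\sqrt{2\alpha'}\big)$ for $m\in[0,1]$. The (one-step) overlap dynamics is $m^{(t+1)}=F_{n,\alpha'}(m^{(t)})$, and $m=0$ is always a fixed point. A retrieval state is a fixed point $m>0$ of $F_{n,\alpha'}$. The critical loading rate $\alpha'_{c,n}$ is the threshold value of $\alpha'$ above which no retrieval state exists, i.e. $\alpha'_{c,n}=\sup\{\alpha'>0:\ \exists\, m\in(0,1],\ F_{n,\alpha'}(m)=m\}$. The critical overlap $m_{c,n}$ is the positive fixed point at the critical loading rate, at which the stable and unstable positive fixed points that exist for $0<\alpha'<\alpha'_{c,n}$ merge (saddle-node bifurcation): it satisfies $F_{n,\alpha'_{c,n}}(m_{c,n})=m_{c,n}$ and $F_{n,\alpha'_{c,n}}'(m_{c,n})=1$,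 where the prime denotes the derivative with respect to $m$. *)

(* Defs.v *)
From Stdlib Require Import Reals.
From Coquelicot Require Import Coquelicot.

Open Scope R_scope.

Definition erf (z : R) : R :=
  2 / sqrt PI * RInt (fun s : R => exp (- s ^ 2)) 0 z.

(* Only used for [n >= 3], so that the truncated [n - 1] is the true one. *)
Definition overlap_map (n : nat) (alpha m : R) : R :=
  erf (m ^ (n - 1) / sqrt (2 * alpha)).

Definition is_retrieval_state (n : nat) (alpha m : R) : Prop :=
  0 < m <= 1 /\ overlap_map n alpha m = m.

(* [Lub_Rbar] is the supremum in the extended reals; for [n >= 3] the set is
   nonempty and bounded, so that [real] does not alter the value. *)
Definition critical_loading_rate (n : nat) : R :=
  real (Lub_Rbar (fun alpha : R =>
    0 < alpha /\ exists m : R, is_retrieval_state n alpha m)).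

(* [m = 1] is never a fixed point since [erf < 1], so that [m] is interior to
   [0, 1] and the two-sided derivative is the one meant. *)
Definition is_critical_overlap (n : nat) (m : R) : Prop :=
  0 < m < 1 /\
  overlap_map n (critical_loading_rate n) m = m /\
  is_derive (overlap_map n (critical_loading_rate n)) m 1.

(* Definite description. With [m = erf x] the two equations give
   [(n - 1) * x * erf' x = erf x], which has exactly one solution [x > 0]
   because [x * erf' x / erf x] decreases strictly from 1 to 0; it is the
   maximizer of [erf x ^ (n - 1) / x], whose maximum is
   [sqrt (2 * critical_loading_rate n)]. *)
Definition critical_overlap (n : nat) : R := iota (is_critical_overlap n).

Definition is_bigO_seq (u v : nat -> R) : Prop :=
  exists C : R, eventually (fun n : nat => Rabs (u n) <= C * Rabs (v n)).

(* Main.v *)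
Require Import Defs.
From Stdlib Require Import Reals Lra Lia.
From Coquelicot Require Import Coquelicot.

Open Scope R_scope.

(** Substituting [m = erf x] turns the fixed-point equation into
    [sqrt (2 * alpha) = erf x ^ (n - 1) / x]. So the critical loading rate is half the
    squared maximum of the right-hand side, and the critical overlap is [erf x] at its
    unique stationary point, where [(n - 1) * x * erf' x = erf x]. Taking logarithms
    there gives [x ^ 2 = ln n + O (ln ln n)]. The stationarity equation also cancels the
    exponential in the tail expansion of [1 - erf x], leaving
    [1 - erf x = (1 + O (/ x ^ 2)) / (2 * (n - 1) * x ^ 2)], which yields both asymptotics. *)

(** * Monotonicity from the sign of a derivative, and a bound on the exponential *)

Lemma strictly_increasing_of_derive_pos (f f' : R -> R) (a b : R) :
  a < b -> (forall x, a <= x <= b -> is_derive f x (f' x)) ->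
  (forall x, a < x < b -> 0 < f' x) -> f a < f b.
Proof.
intros Hab Hd Hpos.
destruct (MVT_cor2 f f' a b Hab) as [c [Hc Hin]].
- intros c Hc. apply is_derive_Reals. now apply Hd.
- specialize (Hpos c Hin). nra.
Qed.

Lemma nondecreasing_of_derive_nonneg (f f' : R -> R) (a b : R) :
  a <= b -> (forall x, a <= x <= b -> is_derive f x (f' x)) ->
  (forall x, a < x < b -> 0 <= f' x) -> f a <= f b.
Proof.
intros [Hab | ->] Hd Hpos; [| lra].
destruct (MVT_cor2 f f' a b Hab) as [c [Hc Hin]].
- intros c Hc. apply is_derive_Reals. now apply Hd.
- specialize (Hpos c Hin). nra.
Qed.

Lemma exp_neg_lt_inv (t : R) : 0 < t -> exp (- t) < / t.
Proof.
intros Ht. rewrite exp_Ropp. apply Rinv_lt_contravar.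
- apply Rmult_lt_0_compat; [lra | apply exp_pos].
- pose proof (exp_ineq1_le t). lra.
Qed.

(** * The Gaussian integral and the tail of erf *)

Lemma continuous_gauss (x : R) : continuous (fun s : R => exp (- s ^ 2)) x.
Proof.
apply (ex_derive_continuous (fun s : R => exp (- s ^ 2))). auto_derive; auto.
Qed.

Lemma ex_RInt_gauss (a b : R) : ex_RInt (fun s : R => exp (- s ^ 2)) a b.
Proof. apply (@ex_RInt_continuous R_CompleteNormedModule). intros z _. apply continuous_gauss. Qed.

Lemma is_derive_gauss_primitive (x : R) :
  is_derive (fun z => RInt (fun s : R => exp (- s ^ 2)) 0 z) x (exp (- x ^ 2)).
Proof.
apply (is_derive_RInt (fun s : R => exp (- s ^ 2)) _ 0 x).
- exists (mkposreal 1 Rlt_0_1). intros y _.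
  apply (@RInt_correct R_CompleteNormedModule), ex_RInt_gauss.
- apply continuous_gauss.
Qed.

(* With [I x] the integral of [exp (- s ^ 2)] over [0, x], the function
   [I ^ 2 + gauss_companion] has derivative 0. *)
Definition gauss_companion (x : R) : R :=
  RInt (fun t : R => exp (- x ^ 2 * (1 + t ^ 2)) / (1 + t ^ 2)) 0 1.

Lemma ex_RInt_gauss_companion (x : R) :
  ex_RInt (fun t : R => exp (- x ^ 2 * (1 + t ^ 2)) / (1 + t ^ 2)) 0 1.
Proof.
apply (@ex_RInt_continuous R_CompleteNormedModule). intros z _.
apply (ex_derive_continuous (fun t : R => exp (- x ^ 2 * (1 + t ^ 2)) / (1 + t ^ 2))).
auto_derive. nra.
Qed.

(** Differentiation under the integral sign cancels the denominator [1 + t ^ 2]. The factor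
    [exp (- x ^ 2)] then comes out, and the substitution [s = x * t] leaves the Gaussian integral
    over [0, x]. *)
Lemma is_derive_gauss_companion (x : R) :
  is_derive gauss_companion x
    (- (2 * exp (- x ^ 2) * RInt (fun s : R => exp (- s ^ 2)) 0 x)).
Proof.
set (f := fun x t : R => exp (- x ^ 2 * (1 + t ^ 2)) / (1 + t ^ 2)).
assert (Hd : forall u t : R,
          is_derive (fun z => f z t) u (- 2 * u * exp (- u ^ 2 * (1 + t ^ 2)))).
{ intros u t. unfold f. auto_derive; [nra |]. simpl. field. nra. }
assert (HD : forall u t : R,
          Derive (fun z => f z t) u = - 2 * u * exp (- u ^ 2 * (1 + t ^ 2)))
  by (intros u t; apply is_derive_unique, Hd).
replace (- (2 * exp (- x ^ 2) * RInt (fun s : R => exp (- s ^ 2)) 0 x))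
  with (RInt (fun t => Derive (fun u => f u t) x) 0 1).
- apply (is_derive_RInt_param f 0 1 x).
  + exists (mkposreal 1 Rlt_0_1). intros y _ t _. eexists. apply Hd.
  + intros t _.
    apply continuity_2d_pt_ext with
      (fun u v : R => - 2 * u * exp (- (u * u) * (1 + v * v))).
    { intros u v. rewrite HD. f_equal. f_equal. ring. }
    apply continuity_2d_pt_mult.
    { apply continuity_2d_pt_mult; [apply continuity_2d_pt_const | apply continuity_2d_pt_id1]. }
    apply (continuity_1d_2d_pt_comp exp).
    { apply derivable_continuous_pt, derivable_pt_exp. }
    apply continuity_2d_pt_mult.
    * apply continuity_2d_pt_opp, continuity_2d_pt_mult; apply continuity_2d_pt_id1.
    * apply continuity_2d_pt_plus; [apply continuity_2d_pt_const |].
      apply continuity_2d_pt_mult; apply continuity_2d_pt_id2.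
  + exists (mkposreal 1 Rlt_0_1). intros y _. apply ex_RInt_gauss_companion.
- apply is_RInt_unique.
  (* [x * t + 0] is the affine form of the substitution, valid for every real [x], including 0. *)
  apply is_RInt_ext with
    (fun t : R => scal (- 2 * exp (- x ^ 2)) (scal x (exp (- (x * t + 0) ^ 2)))).
  { intros t _. rewrite HD. unfold scal; simpl; unfold mult; simpl.
    replace (- (x * (x * 1)) * (1 + t * (t * 1)))
      with (- (x * (x * 1)) + - ((x * t + 0) * ((x * t + 0) * 1))) by ring.
    rewrite exp_plus. ring. }
  replace (- (2 * exp (- x ^ 2) * RInt (fun s : R => exp (- s ^ 2)) 0 x))
    with (scal (- 2 * exp (- x ^ 2)) (RInt (fun s : R => exp (- s ^ 2)) 0 x))
    by (unfold scal; simpl; unfold mult; simpl; ring).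
  apply (@is_RInt_scal R_NormedModule).
  apply (@is_RInt_comp_lin R_NormedModule (fun s => exp (- s ^ 2))).
  replace (x * 0 + 0) with 0 by ring. replace (x * 1 + 0) with x by ring.
  apply (@RInt_correct R_CompleteNormedModule), ex_RInt_gauss.
Qed.

Lemma gauss_companion_0 : gauss_companion 0 = PI / 4.
Proof.
unfold gauss_companion. apply is_RInt_unique.
apply is_RInt_ext with (fun t : R => / (1 + t²)).
{ intros t _. change (/ (1 + t * t) = exp (- 0 ^ 2 * (1 + t ^ 2)) / (1 + t ^ 2)).
  replace (- 0 ^ 2 * (1 + t ^ 2)) with 0 by ring.
  rewrite exp_0. field. nra. }
replace (PI / 4) with (minus (atan 1) (atan 0))
  by (rewrite atan_1, atan_0; unfold minus, plus, opp; simpl; ring).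
apply (@is_RInt_derive R_CompleteNormedModule atan (fun t : R => / (1 + t²))).
- intros t _. apply is_derive_atan.
- intros t _. apply (ex_derive_continuous (fun t : R => / (1 + t²))).
  unfold Rsqr. auto_derive. nra.
Qed.

(** This decay makes [erf] tend to 1, with a rate, without any improper integral. *)
Lemma gauss_companion_bounds (x : R) : 0 <= gauss_companion x <= exp (- x ^ 2).
Proof.
unfold gauss_companion. split.
- apply RInt_ge_0; [lra | apply ex_RInt_gauss_companion |].
  intros t _. apply Rlt_le, Rdiv_lt_0_compat; [apply exp_pos | nra].
- replace (exp (- x ^ 2)) with (RInt (fun _ : R => exp (- x ^ 2)) 0 1)
    by (rewrite RInt_const; unfold scal; simpl; unfold mult; simpl; ring).
  apply RInt_le; [lra | apply ex_RInt_gauss_companion | apply ex_RInt_const |].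
  intros t _.
  assert (exp (- x ^ 2 * (1 + t ^ 2)) <= exp (- x ^ 2)).
  { destruct (Req_dec (x * t) 0) as [E | E].
    - right. f_equal. replace (- x ^ 2 * (1 + t ^ 2)) with (- x ^ 2 - (x * t) ^ 2) by ring.
      rewrite E. ring.
    - left. apply exp_increasing. assert (0 < (x * t) ^ 2) by (apply pow2_gt_0; auto). nra. }
  pose proof (exp_pos (- x ^ 2 * (1 + t ^ 2))).
  apply Rle_div_l; nra.
Qed.

Lemma gauss_primitive_sqr (x : R) :
  0 <= x -> RInt (fun s : R => exp (- s ^ 2)) 0 x ^ 2 = PI / 4 - gauss_companion x.
Proof.
intros Hx.
set (H := fun z => RInt (fun s : R => exp (- s ^ 2)) 0 z ^ 2 + gauss_companion z).
assert (Hd : forall z, is_derive H z 0).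
{ intros z. unfold H.
  pose proof (is_derive_gauss_primitive z) as HI.
  pose proof (is_derive_gauss_companion z) as HG.
  set (I := fun z => RInt (fun s : R => exp (- s ^ 2)) 0 z) in *.
  change (is_derive (fun z => I z ^ 2 + gauss_companion z) z 0).
  auto_derive.
  - repeat split; eexists; eassumption.
  - rewrite (is_derive_unique (fun x : R => I x) _ _ HI).
    rewrite (is_derive_unique (fun x : R => gauss_companion x) _ _ HG).
    fold (I z). simpl. ring. }
assert (E : H x = H 0).
{ destruct Hx as [Hx | <-]; [| reflexivity].
  destruct (MVT_cor2 H (fun _ => 0) 0 x Hx) as [c [Hc _]].
  - intros c _. apply is_derive_Reals, Hd.
  - lra. }
unfold H in E. rewrite RInt_point, gauss_companion_0 in E.
unfold zero in E; simpl in E |- *. lra.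
Qed.

Definition erf_density (x : R) : R := 2 / sqrt PI * exp (- x ^ 2).

Lemma is_derive_erf (x : R) : is_derive erf x (erf_density x).
Proof.
unfold erf, erf_density. apply (is_derive_scal _ x (2 / sqrt PI)).
apply is_derive_gauss_primitive.
Qed.

(** Follows from [3 < PI <= 4]. Crude bounds suffice, since this constant only shifts [x ^ 2] by a
    bounded amount. *)
Lemma two_over_sqrt_PI_bounds : 1 <= 2 / sqrt PI < 3 / 2.
Proof.
pose proof PI2_3_2 as H1. pose proof PI_4 as H2.
pose proof (sqrt_sqrt PI ltac:(lra)) as H3.
assert (0 < sqrt PI) by (apply sqrt_lt_R0; lra).
split; [apply Rle_div_r | apply Rlt_div_l]; nra.
Qed.

Lemma erf_density_pos (x : R) : 0 < erf_density x.
Proof.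
apply Rmult_lt_0_compat; [pose proof two_over_sqrt_PI_bounds; lra | apply exp_pos].
Qed.

Lemma erf_0 : erf 0 = 0.
Proof. unfold erf. rewrite RInt_point. unfold zero; simpl. ring. Qed.

Lemma erf_increasing (x y : R) : x < y -> erf x < erf y.
Proof.
intros Hxy. apply (strictly_increasing_of_derive_pos _ erf_density); auto.
- intros; apply is_derive_erf.
- intros; apply erf_density_pos.
Qed.

Lemma erf_pos (x : R) : 0 < x -> 0 < erf x.
Proof. intros Hx. rewrite <- erf_0. now apply erf_increasing. Qed.

Lemma erf_sqr (x : R) : 0 <= x -> erf x ^ 2 = 1 - 4 / PI * gauss_companion x.
Proof.
intros Hx. pose proof PI_RGT_0 as HP.
assert (0 < sqrt PI) by (apply sqrt_lt_R0; lra).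
unfold erf. rewrite Rpow_mult_distr, gauss_primitive_sqr by auto.
replace ((2 / sqrt PI) ^ 2) with (4 / (sqrt PI * sqrt PI)) by (field; lra).
rewrite sqrt_sqrt by lra. field. lra.
Qed.

(** Since [0 <= erf x <= 1], [1 - erf x <= 1 - erf x ^ 2], which is [4 / PI] times the companion
    integral. *)
Lemma erf_compl_bounds (x : R) : 0 <= x -> 0 <= 1 - erf x <= 2 * exp (- x ^ 2).
Proof.
intros Hx. pose proof PI2_3_2 as HP.
pose proof (gauss_companion_bounds x) as HG. pose proof (erf_sqr x Hx) as HE.
assert (0 <= erf x).
{ destruct Hx as [Hx | <-]; [now apply Rlt_le, erf_pos | rewrite erf_0; lra]. }
assert (0 < 4 / PI <= 2) by (split; [apply Rdiv_lt_0_compat | apply Rle_div_l]; lra).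
assert (0 <= 4 / PI * gauss_companion x <= 2 * exp (- x ^ 2)) by nra.
nra.
Qed.

Lemma erf_lt_1 (x : R) : erf x < 1.
Proof.
apply Rlt_le_trans with (erf (Rmax x 0 + 1)).
- apply erf_increasing. pose proof (Rmax_l x 0). lra.
- pose proof (Rmax_r x 0). pose proof (erf_compl_bounds (Rmax x 0 + 1)). lra.
Qed.

(* The lower bound on [f] forces its limit at infinity to be nonnegative. *)
Lemma nonneg_of_derive_nonpos_of_vanishing (f f' : R -> R) (x : R) :
  0 < x -> (forall y, x <= y -> is_derive f y (f' y)) ->
  (forall y, x < y -> f' y <= 0) ->
  (forall y, x <= y -> 1 <= y -> - 2 * exp (- y ^ 2) <= f y) -> 0 <= f x.
Proof.
intros Hx Hd Hneg Hlim. apply Rnot_lt_le. intros Hf.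
(* With this [y], [- f x <= - f y <= 2 * exp (- y ^ 2) < 2 / y <= - f x], a contradiction. *)
set (y := Rmax x (Rmax 1 (2 / - f x))).
assert (x <= y) by apply Rmax_l.
assert (1 <= y) by (eapply Rle_trans; [apply Rmax_l | apply Rmax_r]).
assert (Hy : 2 / - f x <= y) by (eapply Rle_trans; [apply Rmax_r | apply Rmax_r]).
apply Rle_div_l in Hy; [| lra].
assert (- f x <= - f y).
{ apply (nondecreasing_of_derive_nonneg (fun z => - f z) (fun z => - f' z)); auto.
  - intros z Hz. apply (@is_derive_opp R_AbsRing R_NormedModule). apply Hd; lra.
  - intros z Hz. specialize (Hneg z). lra. }
specialize (Hlim y ltac:(auto) ltac:(auto)).
assert (He : exp (- y ^ 2) < / y).
{ apply Rlt_le_trans with (/ (y ^ 2)); [apply exp_neg_lt_inv; nra |].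
  apply Rinv_le_contravar; nra. }
apply (Rmult_lt_compat_r y) in He; [| lra]. rewrite Rinv_l in He by lra.
nra.
Qed.

(** The right-hand side is the first term of the asymptotic series of the tail. The difference of
    the two sides decreases and vanishes at infinity, hence is nonnegative. *)
Lemma erf_compl_upper (x : R) : 0 < x -> 1 - erf x <= erf_density x / (2 * x).
Proof.
intros Hx.
enough (0 <= erf_density x / (2 * x) - (1 - erf x)) by lra.
apply (nonneg_of_derive_nonpos_of_vanishing
  (fun z => erf_density z / (2 * z) - (1 - erf z))
  (fun z => - (erf_density z / (2 * z ^ 2))) x Hx).
- intros y Hy. pose proof (is_derive_erf y) as HE.
  unfold erf_density in *. auto_derive.
  + split; [lra |]. split; [eexists; apply HE | auto].
  + rewrite (is_derive_unique (fun x : R => erf x) _ _ HE).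
    replace (y * (y * 1)) with (y ^ 2) by ring.
    assert (sqrt PI <> 0) by (apply Rgt_not_eq, sqrt_lt_R0, PI_RGT_0).
    simpl. field. split; lra.
- intros y Hy. assert (0 < erf_density y / (2 * y ^ 2)); [| lra].
  apply Rdiv_lt_0_compat; [apply erf_density_pos | nra].
- intros y Hy _. pose proof (erf_compl_bounds y ltac:(lra)).
  assert (0 < erf_density y / (2 * y)); [| lra].
  apply Rdiv_lt_0_compat; [apply erf_density_pos | nra].
Qed.

(** Same argument with two terms of the asymptotic series, whose truncation now lies below the
    tail. *)
Lemma erf_compl_lower (x : R) :
  0 < x -> erf_density x / (2 * x) * (1 - / (2 * x ^ 2)) <= 1 - erf x.
Proof.
intros Hx.
enough (0 <= 1 - erf x - erf_density x / (2 * x) * (1 - / (2 * x ^ 2))) by lra.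
apply (nonneg_of_derive_nonpos_of_vanishing
  (fun z => 1 - erf z - erf_density z / (2 * z) * (1 - / (2 * z ^ 2)))
  (fun z => - (3 * erf_density z / (4 * z ^ 4))) x Hx).
- intros y Hy. pose proof (is_derive_erf y) as HE.
  unfold erf_density in *. auto_derive.
  + split; [eexists; apply HE |]. repeat split; nra.
  + rewrite (is_derive_unique (fun x : R => erf x) _ _ HE).
    replace (y * (y * 1)) with (y ^ 2) by ring.
    assert (sqrt PI <> 0) by (apply Rgt_not_eq, sqrt_lt_R0, PI_RGT_0).
    simpl. field. split; lra.
- intros y Hy. assert (0 < 3 * erf_density y / (4 * y ^ 4)); [| lra].
  apply Rdiv_lt_0_compat; [pose proof (erf_density_pos y); lra |].
  assert (0 < y ^ 4) by (apply pow_lt; lra). lra.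
- intros y Hy Hy1. pose proof (erf_compl_bounds y ltac:(lra)).
  pose proof two_over_sqrt_PI_bounds. pose proof (exp_pos (- y ^ 2)).
  assert (erf_density y / (2 * y) * (1 - / (2 * y ^ 2)) <= 2 * exp (- y ^ 2)); [| lra].
  assert (0 < / (2 * y ^ 2)) by (apply Rinv_0_lt_compat; nra).
  assert (0 < erf_density y / (2 * y) <= 2 * exp (- y ^ 2)); [| nra].
  split; [apply Rdiv_lt_0_compat; [apply erf_density_pos | lra] |].
  unfold erf_density. apply Rle_div_l; nra.
Qed.

(** * The stationary point *)

Lemma is_derive_erf_density (x : R) :
  is_derive erf_density x (- 2 * x * erf_density x).
Proof. unfold erf_density. auto_derive; auto. simpl. ring. Qed.

(* Up to a positive factor, minus the derivative of [overlap_scale N] below. *)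
Definition stationarity_defect (N : nat) (x : R) : R :=
  erf x - INR N * (x * erf_density x).

(** For [N >= 2] the second factor changes sign once on [x > 0]: the defect falls from 0 at the
    origin, then rises, so it has at most one positive zero. *)
Lemma is_derive_stationarity_defect (N : nat) (x : R) :
  is_derive (stationarity_defect N) x
    (erf_density x * (2 * INR N * x ^ 2 - (INR N - 1))).
Proof.
pose proof (is_derive_erf x) as HE. pose proof (is_derive_erf_density x) as HD.
unfold stationarity_defect. auto_derive.
- repeat split; eexists; eassumption.
- rewrite (is_derive_unique (fun x : R => erf x) _ _ HE).
  rewrite (is_derive_unique (fun x : R => erf_density x) _ _ HD). ring.
Qed.

Lemma stationarity_defect_neg (N : nat) (x : R) :
  0 < x -> 2 * INR N * x ^ 2 <= INR N - 1 -> stationarity_defect N x < 0.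
Proof.
intros Hx HN.
assert (H0 : stationarity_defect N 0 = 0)
  by (unfold stationarity_defect; rewrite erf_0; ring).
enough (- stationarity_defect N 0 < - stationarity_defect N x) by lra.
apply (strictly_increasing_of_derive_pos (fun z => - stationarity_defect N z)
  (fun z => - (erf_density z * (2 * INR N * z ^ 2 - (INR N - 1))))); auto.
- intros z _. apply (@is_derive_opp R_AbsRing R_NormedModule), is_derive_stationarity_defect.
- intros z Hz. pose proof (erf_density_pos z). pose proof (pos_INR N) as HN0.
  assert (0 < INR N).
  { destruct HN0 as [| HN0]; auto. rewrite <- HN0 in HN. nra. }
  assert (z ^ 2 < x ^ 2) by nra.
  assert (INR N * z ^ 2 < INR N * x ^ 2) by (apply Rmult_lt_compat_l; auto). nra.
Qed.

Lemma stationarity_defect_increasing (N : nat) (x y : R) :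
  0 < x < y -> 0 < INR N -> INR N - 1 <= 2 * INR N * x ^ 2 ->
  stationarity_defect N x < stationarity_defect N y.
Proof.
intros Hxy HN HNx.
apply (strictly_increasing_of_derive_pos _
  (fun z => erf_density z * (2 * INR N * z ^ 2 - (INR N - 1)))); [lra | |].
- intros z _. apply is_derive_stationarity_defect.
- intros z Hz. pose proof (erf_density_pos z).
  assert (x ^ 2 < z ^ 2) by nra.
  assert (INR N * x ^ 2 < INR N * z ^ 2) by (apply Rmult_lt_compat_l; auto). nra.
Qed.

Definition is_stationary (N : nat) (x : R) : Prop :=
  0 < x /\ INR N * (x * erf_density x) = erf x.

Lemma is_stationary_lower (N : nat) (x : R) :
  is_stationary N x -> INR N - 1 < 2 * INR N * x ^ 2.
Proof.
intros [Hx H]. apply Rnot_le_lt. intros HN.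
apply stationarity_defect_neg in HN; auto. unfold stationarity_defect in HN. lra.
Qed.

(** The zero [x] lies on the rising branch. A point [y < x] is either on the falling branch, where
    the defect is already negative, or on the rising branch below its zero. *)
Lemma stationarity_defect_sign (N : nat) (x y : R) :
  0 < INR N -> is_stationary N x -> 0 < y ->
  (y < x -> stationarity_defect N y < 0) /\ (x < y -> 0 < stationarity_defect N y).
Proof.
intros HN Hst Hy. pose proof (is_stationary_lower N x Hst) as HNx.
destruct Hst as [Hx H].
assert (H0 : stationarity_defect N x = 0) by (unfold stationarity_defect; lra).
split; intros Hyx.
- destruct (Rle_or_lt (2 * INR N * y ^ 2) (INR N - 1)).
  + now apply stationarity_defect_neg.
  + rewrite <- H0. apply stationarity_defect_increasing; lra.
- rewrite <- H0. apply stationarity_defect_increasing; lra.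
Qed.

Lemma is_stationary_unique (N : nat) (x y : R) :
  0 < INR N -> is_stationary N x -> is_stationary N y -> y = x.
Proof.
intros HN Hx [Hy H].
destruct (stationarity_defect_sign N x y HN Hx Hy) as [Hlt Hgt].
assert (stationarity_defect N y = 0) by (unfold stationarity_defect; lra).
destruct (Rtotal_order y x) as [Hc | [Hc | Hc]]; auto.
- specialize (Hlt Hc). lra.
- specialize (Hgt Hc). lra.
Qed.

Lemma is_stationary_exists (N : nat) : (2 <= N)%nat -> exists x, is_stationary N x.
Proof.
intros HN2. apply le_INR in HN2. simpl in HN2.
set (M := INR N) in *.
(* At [1 / 3] the defect is still on its falling branch, as [2 * M / 9 <= M - 1] for [M >= 2]. At
   [2 * M] the Gaussian factor outweighs [M ^ 2], so the defect is close to 1. *)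
destruct (IVT (stationarity_defect N) (1 / 3) (2 * M)) as [x [Hx H]].
- intros x. apply derivable_continuous_pt. eexists.
  apply is_derive_Reals, is_derive_stationarity_defect.
- lra.
- apply stationarity_defect_neg; [lra |]. fold M. lra.
- unfold stationarity_defect. fold M.
  pose proof (erf_compl_bounds (2 * M) ltac:(lra)) as HE.
  pose proof two_over_sqrt_PI_bounds as HS.
  (* [exp (- x ^ 2)] is squared so that the linear bound on each factor suffices. *)
  assert (Hexp : exp (- (2 * M) ^ 2) <= / (4 * M ^ 4)).
  { replace (- (2 * M) ^ 2) with (- (2 * M ^ 2) + - (2 * M ^ 2)) by ring.
    rewrite exp_plus. pose proof (exp_neg_lt_inv (2 * M ^ 2) ltac:(nra)).
    pose proof (exp_pos (- (2 * M ^ 2))).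
    replace (/ (4 * M ^ 4)) with (/ (2 * M ^ 2) * / (2 * M ^ 2)) by (field; lra).
    nra. }
  assert (H4 : M * M * (M * M) * / (4 * M ^ 4) = / 4) by (field; lra).
  pose proof (exp_pos (- (2 * M) ^ 2)).
  assert (HMM : 4 <= M * M) by nra.
  assert (M * M * (M * M) * exp (- (2 * M) ^ 2) <= / 4).
  { rewrite <- H4. apply Rmult_le_compat_l; nra. }
  unfold erf_density.
  set (e := exp (- (2 * M) ^ 2)) in *.
  assert (He1 : 4 * e <= M * M * e) by (apply Rmult_le_compat_r; lra).
  assert (He2 : 4 * (M * M * e) <= M * M * (M * M * e)) by (apply Rmult_le_compat_r; nra).
  assert (2 / sqrt PI * (M * M * e) <= 3 / 2 * (M * M * e)) by (apply Rmult_le_compat_r; nra).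
  replace (M * (2 * M * (2 / sqrt PI * e))) with (2 * (2 / sqrt PI * (M * M * e))) by ring.
  lra.
- exists x. split; [lra |]. unfold stationarity_defect in H. fold M in H |- *. lra.
Qed.

(* The fixed points of [overlap_map (S N) alpha] in (0, 1] are the [erf x] for which
   [sqrt (2 * alpha) = overlap_scale N x]. *)
Definition overlap_scale (N : nat) (x : R) : R := erf x ^ N / x.

Lemma overlap_scale_pos (N : nat) (x : R) : 0 < x -> 0 < overlap_scale N x.
Proof. intros Hx. apply Rdiv_lt_0_compat; auto. now apply pow_lt, erf_pos. Qed.

Lemma is_derive_overlap_scale (N : nat) (x : R) :
  0 < x -> (1 <= N)%nat ->
  is_derive (overlap_scale N) x
    (- (erf x ^ (N - 1) * stationarity_defect N x / x ^ 2)).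
Proof.
intros Hx HN. pose proof (is_derive_erf x) as HE. unfold overlap_scale, stationarity_defect.
auto_derive.
- repeat split; [eexists; eassumption | lra].
- rewrite (is_derive_unique (fun x : R => erf x) _ _ HE).
  destruct N as [| k]; [lia |].
  replace (S k - 1)%nat with k by lia.
  replace (Init.Nat.pred (S k)) with k by reflexivity.
  rewrite <- tech_pow_Rmult. field. lra.
Qed.

(** The derivative of the scale has the sign opposite to the defect, so the scale rises up to [x]
    and falls after it. *)
Lemma overlap_scale_le_stationary (N : nat) (x y : R) :
  (1 <= N)%nat -> is_stationary N x -> 0 < y -> overlap_scale N y <= overlap_scale N x.
Proof.
intros HN Hst Hy. pose proof Hst as [Hx _].
assert (HN' : 0 < INR N) by (apply lt_0_INR; lia).
assert (Hfac : forall z, 0 < z -> 0 < erf z ^ (N - 1) / z ^ 2).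
{ intros z Hz. apply Rdiv_lt_0_compat; [now apply pow_lt, erf_pos | nra]. }
destruct (Rle_or_lt y x) as [Hyx | Hyx].
- apply (nondecreasing_of_derive_nonneg _
    (fun z => - (erf z ^ (N - 1) * stationarity_defect N z / z ^ 2))); auto.
  + intros z Hz. apply is_derive_overlap_scale; auto; lra.
  + intros z Hz. specialize (Hfac z ltac:(lra)).
    destruct (stationarity_defect_sign N x z HN' Hst ltac:(lra)) as [Hlt _].
    specialize (Hlt ltac:(lra)).
    replace (erf z ^ (N - 1) * stationarity_defect N z / z ^ 2)
      with (erf z ^ (N - 1) / z ^ 2 * stationarity_defect N z) by (field; lra).
    nra.
- enough (- overlap_scale N x <= - overlap_scale N y) by lra.
  apply (nondecreasing_of_derive_nonneg (fun z => - overlap_scale N z)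
    (fun z => - - (erf z ^ (N - 1) * stationarity_defect N z / z ^ 2))); [lra | |].
  + intros z Hz. apply (@is_derive_opp R_AbsRing R_NormedModule).
    apply is_derive_overlap_scale; auto; lra.
  + intros z Hz. specialize (Hfac z ltac:(lra)).
    destruct (stationarity_defect_sign N x z HN' Hst ltac:(lra)) as [_ Hgt].
    specialize (Hgt ltac:(lra)).
    replace (erf z ^ (N - 1) * stationarity_defect N z / z ^ 2)
      with (erf z ^ (N - 1) / z ^ 2 * stationarity_defect N z) by (field; lra).
    nra.
Qed.

(** * The critical quantities expressed through the stationary point *)

(** A retrieval state makes [sqrt (2 * alpha)] a value of the scale, hence at most its maximum. The
    supremum is attained, with retrieval state [erf x]. *)
Lemma critical_loading_rate_eq (n : nat) (x : R) :
  (2 <= n)%nat -> is_stationary (n - 1) x ->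
  critical_loading_rate n = overlap_scale (n - 1) x ^ 2 / 2.
Proof.
intros Hn Hst. pose proof Hst as [Hx _].
set (N := (n - 1)%nat) in *.
unfold critical_loading_rate.
rewrite (is_lub_Rbar_unique _ (overlap_scale N x ^ 2 / 2)); [reflexivity |].
split.
- intros alpha [Ha [m [[Hm0 Hm1] Hm]]]. unfold overlap_map in Hm. fold N in Hm. simpl.
  assert (Hs : 0 < sqrt (2 * alpha)) by (apply sqrt_lt_R0; lra).
  pose proof (sqrt_sqrt (2 * alpha) ltac:(lra)) as Hss.
  set (y := m ^ N / sqrt (2 * alpha)) in *.
  assert (Hy : 0 < y) by (apply Rdiv_lt_0_compat; [now apply pow_lt | auto]).
  assert (Hg : overlap_scale N y = sqrt (2 * alpha)).
  { unfold overlap_scale. rewrite Hm. unfold y. field. split; [lra |].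
    apply Rgt_not_eq. now apply pow_lt. }
  assert (overlap_scale N y <= overlap_scale N x)
    by (apply overlap_scale_le_stationary; auto; unfold N; lia).
  nra.
- intros b Hb. apply Hb. pose proof (overlap_scale_pos N x Hx) as Hg. split; [nra |].
  exists (erf x). split; [split; [now apply erf_pos | apply Rlt_le, erf_lt_1] |].
  unfold overlap_map. fold N.
  replace (2 * (overlap_scale N x ^ 2 / 2)) with (overlap_scale N x ^ 2) by field.
  rewrite sqrt_pow2 by lra. f_equal. unfold overlap_scale. field.
  split; [lra |]. apply Rgt_not_eq. now apply pow_lt, erf_pos.
Qed.

Lemma is_derive_overlap_map (n : nat) (alpha m : R) :
  (2 <= n)%nat -> 0 < alpha ->
  is_derive (overlap_map n alpha) m
    (INR (n - 1) * m ^ (n - 2) / sqrt (2 * alpha)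
     * erf_density (m ^ (n - 1) / sqrt (2 * alpha))).
Proof.
intros Hn Ha. unfold overlap_map.
assert (Hs : 0 < sqrt (2 * alpha)) by (apply sqrt_lt_R0; lra).
apply (is_derive_comp erf (fun m => m ^ (n - 1) / sqrt (2 * alpha))).
- apply is_derive_erf.
- auto_derive; auto. replace (Init.Nat.pred (n - 1)) with (n - 2)%nat by lia.
  field. lra.
Qed.

(** Multiplying the condition that the derivative is 1 by [m] turns it into the stationarity
    equation for the argument [y] of [erf], so uniqueness of the stationary point gives [y = x]. *)
Lemma is_critical_overlap_iff (n : nat) (x m : R) :
  (2 <= n)%nat -> is_stationary (n - 1) x -> is_critical_overlap n m <-> m = erf x.
Proof.
intros Hn Hst. pose proof Hst as [Hx Heq].
pose proof (critical_loading_rate_eq n x Hn Hst) as Hac.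
pose proof (overlap_scale_pos (n - 1) x Hx) as Hg.
assert (Ha : 0 < critical_loading_rate n) by (rewrite Hac; nra).
assert (Hs : sqrt (2 * critical_loading_rate n) = overlap_scale (n - 1) x).
{ rewrite Hac.
  replace (2 * (overlap_scale (n - 1) x ^ 2 / 2)) with (overlap_scale (n - 1) x ^ 2) by field.
  apply sqrt_pow2. lra. }
unfold is_critical_overlap.
assert (Hpow : forall z, z ^ (n - 1) = z * z ^ (n - 2)).
{ intros z. replace (n - 1)%nat with (S (n - 2)) by lia. reflexivity. }
split.
- intros [[Hm0 Hm1] [Hfix Hder]].
  pose proof (is_derive_overlap_map n _ m Hn Ha) as Hder'.
  apply is_derive_unique in Hder. apply is_derive_unique in Hder'.
  rewrite Hder in Hder'. unfold overlap_map in Hfix. rewrite Hs in *.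
  set (y := m ^ (n - 1) / overlap_scale (n - 1) x) in *.
  assert (Hy : 0 < y) by (apply Rdiv_lt_0_compat; [now apply pow_lt | auto]).
  assert (Hyst : is_stationary (n - 1) y).
  { split; auto. rewrite Hfix.
    rewrite <- (Rmult_1_r m), Hder'.
    unfold y at 1. rewrite Hpow. field. lra. }
  rewrite <- Hfix. f_equal. apply (is_stationary_unique (n - 1)); auto.
  apply lt_0_INR. lia.
- intros ->. pose proof (erf_pos x Hx) as HE. pose proof (erf_lt_1 x).
  assert (HEp : 0 < erf x ^ (n - 2)) by now apply pow_lt.
  assert (Hback : erf x ^ (n - 1) / overlap_scale (n - 1) x = x).
  { unfold overlap_scale. field. split; [lra |]. apply Rgt_not_eq. now apply pow_lt. }
  split; [lra |]. split.
  + unfold overlap_map. rewrite Hs, Hback. reflexivity.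
  + pose proof (is_derive_overlap_map n _ (erf x) Hn Ha) as Hder.
    rewrite Hs, Hback in Hder.
    replace (INR (n - 1) * erf x ^ (n - 2) / overlap_scale (n - 1) x * erf_density x)
      with 1 in Hder; [exact Hder |].
    unfold overlap_scale. rewrite Hpow.
    replace (INR (n - 1) * erf x ^ (n - 2) / (erf x * erf x ^ (n - 2) / x) * erf_density x)
      with (INR (n - 1) * (x * erf_density x) / erf x) by (field; lra).
    rewrite Heq. field. lra.
Qed.

Lemma critical_overlap_eq (n : nat) (x : R) :
  (2 <= n)%nat -> is_stationary (n - 1) x -> critical_overlap n = erf x.
Proof.
intros Hn Hst. unfold critical_overlap.
apply (@iota_unique R_AbsRing R_CompleteNormedModule (is_critical_overlap n)).
- intros m Hm. now apply (is_critical_overlap_iff n x m).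
- now apply (is_critical_overlap_iff n x (erf x)).
Qed.

(** * Asymptotics *)

(** Applied with [t = 1 - erf x]: the tail is so small that the power of [erf x] in the scale stays
    close to 1. *)
Lemma bernoulli_ineq (N : nat) (t : R) : 0 <= t <= 1 -> 1 - INR N * t <= (1 - t) ^ N.
Proof.
intros Ht. induction N as [| N IH]; [simpl; lra |].
rewrite S_INR, <- tech_pow_Rmult. pose proof (pos_INR N).
assert ((1 - INR N * t) * (1 - t) <= (1 - t) ^ N * (1 - t))
  by (apply Rmult_le_compat_r; lra).
assert (0 <= INR N * (t * t)) by (apply Rmult_le_pos; nra). lra.
Qed.

Lemma exp_le_inv (x y : R) : exp x <= exp y -> x <= y.
Proof.
intros H. apply Rnot_lt_le. intros Hlt. apply exp_increasing in Hlt. lra.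
Qed.

Lemma exp_3_ge : 8 <= exp 3.
Proof.
replace 3 with (1 + (1 + 1)) by ring. rewrite !exp_plus.
pose proof (exp_ineq1_le 1). nra.
Qed.

(* At a stationary point [erf_density x / (2 * x) = erf x / (2 * N * x ^ 2)], so the
   tail bounds for [1 - erf] become bounds in [x ^ 2] alone. *)
Lemma stationary_tail (N : nat) (x : R) :
  0 < INR N -> is_stationary N x ->
  (1 - / (2 * x ^ 2)) * erf x <= 2 * INR N * x ^ 2 * (1 - erf x) <= erf x.
Proof.
intros HN [Hx H].
assert (Hd : erf_density x / (2 * x) = erf x / (2 * INR N * x ^ 2))
  by (rewrite <- H; field; lra).
pose proof (erf_compl_upper x Hx) as HU. pose proof (erf_compl_lower x Hx) as HL.
rewrite Hd in HU, HL.
assert (HK : 0 < 2 * INR N * x ^ 2) by (apply Rmult_lt_0_compat; nra).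
apply (Rmult_le_compat_l (2 * INR N * x ^ 2)) in HU, HL; [| lra | lra].
split.
- eapply Rle_trans; [right | apply HL]. field. lra.
- eapply Rle_trans; [apply HU | right]. field. lra.
Qed.

(** Stationarity reads [exp (x ^ 2) * erf x = 2 / sqrt PI * N * x], and the tail bound together with
    [2 * N * x ^ 2 > 1] gives [1 / 2 <= erf x]. *)
Lemma stationary_exp_bounds (N : nat) (x : R) :
  (2 <= N)%nat -> is_stationary N x ->
  1 / 2 <= x /\ INR N / 2 <= exp (x ^ 2) <= 3 * INR N * x.
Proof.
intros HN2 Hst. apply le_INR in HN2. simpl in HN2.
pose proof (is_stationary_lower N x Hst) as HN.
pose proof (stationary_tail N x ltac:(lra) Hst) as [_ HT].
destruct Hst as [Hx H].
pose proof (erf_lt_1 x) as HE1. pose proof (erf_pos x Hx) as HE0.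
assert (HE : 1 / 2 <= erf x).
{ assert (1 * (1 - erf x) <= 2 * INR N * x ^ 2 * (1 - erf x))
    by (apply Rmult_le_compat_r; lra). lra. }
assert (Hx2 : 1 / 2 <= x).
{ apply Rnot_lt_le. intros Hlt. assert (x ^ 2 <= 1 / 4) by nra.
  assert (INR N * x ^ 2 <= INR N * (1 / 4)) by (apply Rmult_le_compat_l; lra). lra. }
pose proof two_over_sqrt_PI_bounds as Hc. set (c := 2 / sqrt PI) in *.
assert (Hexp : exp (x ^ 2) * erf x = c * (INR N * x)).
{ rewrite <- H. unfold erf_density. fold c. rewrite exp_Ropp. field.
  apply Rgt_not_eq, exp_pos. }
pose proof (exp_pos (x ^ 2)).
assert (INR N * (1 / 2) <= INR N * x) by (apply Rmult_le_compat_l; lra).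
split; [lra |]. split.
- assert (1 * (INR N * x) <= c * (INR N * x)) by (apply Rmult_le_compat_r; lra). nra.
- assert (c * (INR N * x) <= 3 / 2 * (INR N * x)) by (apply Rmult_le_compat_r; lra). nra.
Qed.

Lemma stationary_sqr_bounds (n : nat) (x : R) :
  (3 <= n)%nat -> is_stationary (n - 1) x -> 1 <= ln (ln (INR n)) -> 3 <= ln (INR n) ->
  ln (INR n) - 2 * ln (ln (INR n)) <= x ^ 2 <= ln (INR n) + 4 * ln (ln (INR n)).
Proof.
intros Hn Hst Hl HL3.
destruct (stationary_exp_bounds (n - 1) x ltac:(lia) Hst) as [Hx [Hlow Hup]].
rewrite minus_INR in Hlow, Hup by lia.
apply le_INR in Hn. simpl in Hn, Hlow, Hup.
set (L := ln (INR n)) in *. set (l := ln L) in *.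
assert (HexpL : exp L = INR n) by (apply exp_ln; lra).
assert (Hexpl : exp l = L) by (apply exp_ln; lra).
change (x * (x * 1)) with (x ^ 2) in Hlow, Hup.
set (y := x ^ 2) in *. pose proof exp_3_ge as He3.
split.
(* Enough because [1 <= l]; it holds because [exp (L - 2) <= n / 4 <= (n - 1) / 2 <= exp y]. *)
- enough (L - 2 <= y) by lra.
  apply exp_le_inv.
  replace (L - 2) with (L + - (1 + 1)) by ring.
  rewrite exp_plus, exp_Ropp, exp_plus, HexpL.
  pose proof (exp_ineq1_le 1).
  assert (4 <= exp 1 * exp 1) by nra.
  assert (exp y * 4 <= exp y * (exp 1 * exp 1))
    by (apply Rmult_le_compat_l; [apply Rlt_le, exp_pos | auto]).
  apply Rle_div_l; lra.
(* Bootstrap: absorbing [x] into [exp (y / 2)] gives [exp (y / 2) <= 3 * (n - 1)], hence a crude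
   bound on [y]. It yields [x <= 2 * sqrt L = 2 * exp (l / 2)], which is fed back into the upper
   bound on [exp y]. *)
- assert (Hcrude : y <= 4 * L).
  { enough (y / 2 <= 3 + L) by lra.
    apply exp_le_inv. rewrite exp_plus, HexpL.
    pose proof (exp_ineq1_le (y / 2)). pose proof (exp_pos (y / 2)).
    replace y with (y / 2 + y / 2) in Hup by field. rewrite exp_plus in Hup.
    assert (x <= exp (y / 2)) by (unfold y in *; nra).
    assert (3 * (INR n - 1) * x <= 3 * (INR n - 1) * exp (y / 2))
      by (apply Rmult_le_compat_l; lra).
    assert (exp (y / 2) <= 3 * (INR n - 1)) by nra. nra. }
  enough (y <= 3 + L + l / 2) by lra.
  apply exp_le_inv. rewrite !exp_plus, HexpL.
  assert (Hhalf : exp (l / 2) * exp (l / 2) = L)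
    by (rewrite <- exp_plus, <- Hexpl; f_equal; field).
  pose proof (exp_pos (l / 2)).
  assert (x <= 2 * exp (l / 2)) by (unfold y in *; nra).
  assert (3 * (INR n - 1) * x <= 3 * INR n * (2 * exp (l / 2)))
    by (apply Rmult_le_compat; lra).
  assert (6 * (INR n * exp (l / 2)) <= exp 3 * (INR n * exp (l / 2)))
    by (apply Rmult_le_compat_r; nra).
  lra.
Qed.

Lemma eventually_ln_ln_ge (A : R) :
  eventually (fun n : nat => (3 <= n)%nat /\ A <= ln (ln (INR n))).
Proof.
destruct (INR_unbounded (exp (exp A))) as [N HN].
exists (max 3 N). intros n Hn. split; [lia |].
assert (HNn : INR N <= INR n) by (apply le_INR; lia).
rewrite <- (ln_exp A). apply ln_le; [apply exp_pos |].
rewrite <- (ln_exp (exp A)). apply ln_le; [apply exp_pos | lra].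
Qed.

Lemma critical_relative_errors :
  eventually (fun n : nat =>
    Rabs (2 * ln (INR n) * critical_loading_rate n - 1)
      <= 14 * Rabs (ln (ln (INR n)) / ln (INR n)) /\
    Rabs (2 * INR n * ln (INR n) * (1 - critical_overlap n) - 1)
      <= 14 * Rabs (ln (ln (INR n)) / ln (INR n))).
Proof.
(* From [l >= 32] comes [L = exp l >= (l / 2) ^ 2 >= 8 * l], so that [r = l / L] is at most [1 / 8]
   and products of errors of order [r] are again of order [r]. *)
generalize (eventually_ln_ln_ge 32). apply filter_imp. intros n [Hn Hl].
destruct (is_stationary_exists (n - 1) ltac:(lia)) as [x Hst].
rewrite (critical_loading_rate_eq n x), (critical_overlap_eq n x) by (auto; lia).
assert (Hn3 : 3 <= INR n) by (apply le_INR in Hn; simpl in Hn; lra).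
assert (HLpos : 0 < ln (INR n)) by (rewrite <- ln_1; apply ln_increasing; lra).
pose proof (stationary_sqr_bounds n x Hn Hst) as Hy.
pose proof (exp_ln (ln (INR n)) HLpos) as Hexpl.
pose proof (exp_ln (INR n) ltac:(lra)) as HexpL.
set (L := ln (INR n)) in *. set (l := ln L) in *.
assert (HlL : 8 * l <= L).
{ replace l with (l / 2 + l / 2) in Hexpl by field. rewrite exp_plus in Hexpl.
  pose proof (exp_ineq1_le (l / 2)). nra. }
specialize (Hy ltac:(lra) ltac:(lra)).
assert (HLn : L <= INR n) by (pose proof (exp_ineq1_le L); lra).
assert (HN1 : INR (n - 1) = INR n - 1) by (rewrite minus_INR by lia; simpl; ring).
pose proof (stationary_tail (n - 1) x ltac:(lra) Hst) as HT.
destruct Hst as [Hx _].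
pose proof (erf_pos x Hx) as HE0. pose proof (erf_lt_1 x) as HE1.
pose proof (bernoulli_ineq (n - 1) (1 - erf x) ltac:(lra)) as HB.
replace (1 - (1 - erf x)) with (erf x) in HB by ring.
assert (HP : 0 < erf x ^ (n - 1) <= 1).
{ split; [now apply pow_lt |]. rewrite <- (pow1 (n - 1)). apply pow_incr. lra. }
unfold overlap_scale.
set (P := erf x ^ (n - 1)) in *.
rewrite HN1 in HT, HB.
set (E := erf x) in *.
set (N := INR n - 1) in *.
replace (2 * L * ((P / x) ^ 2 / 2)) with (L / x ^ 2 * P ^ 2) by (field; lra).
set (y := x ^ 2) in *.
set (r := l / L).
assert (Hrl : r * L = l) by (unfold r; field; lra).
assert (Hr : 0 < r <= 1 / 8).
{ split; [apply Rdiv_lt_0_compat; lra | apply Rle_div_l; lra]. }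
rewrite (Rabs_pos_eq r) by lra.
assert (Hyl : 3 / 4 * L <= y) by lra.
assert (Hiy : 0 < / (2 * y) <= r).
{ split; [apply Rinv_0_lt_compat; lra |].
  apply (Rmult_le_reg_r (2 * y)); [lra |]. rewrite Rinv_l by lra. nra. }
assert (Hq : 1 - 4 * r <= L / y <= 1 + 4 * r).
{ split; [apply Rle_div_r | apply Rle_div_l]; try lra; nra. }
set (q := L / y) in *.
assert (HT1 : N * (1 - E) <= / (2 * y)).
{ apply (Rmult_le_reg_r (2 * y)); [lra |]. rewrite Rinv_l by lra. lra. }
assert (HEr : 1 - r <= E) by (unfold N in *; nra).
split; apply Rabs_le.
(* Bernoulli and [HT1] give [P >= 1 - r]. Together with the bounds on [q] this puts the product
   between [1 - 6 * r] and [1 + 4 * r]. *)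
- assert (1 - 2 * r <= P ^ 2 <= 1) by nra. nra.
- set (w := 2 * N * y * (1 - E)) in *.
  assert (Hw : 1 - 2 * r <= w <= 1).
  { split; [| lra]. apply Rle_trans with ((1 - / (2 * y)) * E); [| lra].
    apply Rle_trans with ((1 - r) * (1 - r)); [nra |].
    apply Rmult_le_compat; lra. }
  (* Cost of replacing [n - 1] by [n]: the excess is [/ N], and
     [2 * r * N >= r * n >= r * L = l >= 1]. *)
  assert (Hs : 1 <= INR n / N <= 1 + 2 * r).
  { unfold N. split; [apply Rle_div_r | apply Rle_div_l]; try lra. nra. }
  replace (2 * INR n * L * (1 - E)) with (w * (INR n / N * q))
    by (unfold w, q; field; unfold N; lra).
  set (s := INR n / N) in *.
  assert (1 - 4 * r <= s * q <= 1 + 8 * r) by nra.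
  nra.
Qed.

Theorem mainTheorem1 :
  (exists eps : nat -> R,
     is_bigO_seq eps (fun n : nat => ln (ln (INR n)) / ln (INR n)) /\
     forall n : nat, (3 <= n)%nat ->
       critical_loading_rate n = 1 / (2 * ln (INR n)) * (1 + eps n)) /\
  (exists eps : nat -> R,
     is_bigO_seq eps (fun n : nat => ln (ln (INR n)) / ln (INR n)) /\
     forall n : nat, (3 <= n)%nat ->
       critical_overlap n = 1 - 1 / (2 * INR n * ln (INR n)) * (1 + eps n)).
Proof.
assert (Hpos : forall n : nat, (3 <= n)%nat -> 0 < INR n /\ 0 < ln (INR n)).
{ intros n Hn. apply le_INR in Hn. simpl in Hn. split; [lra |].
  rewrite <- ln_1. apply ln_increasing; lra. }
pose proof critical_relative_errors as Herr.
split.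
(* The witness is the exact relative error, so the identity holds for every [n >= 3], where
   [ln n > 0]; only its bound is asymptotic. *)
- exists (fun n => 2 * ln (INR n) * critical_loading_rate n - 1). split.
  + exists 14. revert Herr. apply filter_imp. tauto.
  + intros n Hn. specialize (Hpos n Hn). field. lra.
- exists (fun n => 2 * INR n * ln (INR n) * (1 - critical_overlap n) - 1). split.
  + exists 14. revert Herr. apply filter_imp. tauto.
  + intros n Hn. specialize (Hpos n Hn). field. lra.
Qed.
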